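(* Let the Finsler manifolds $(M,L)$ and $(M,\tilde L)$ be conformal with $\tilde g=e^{2\sigma(x)}g$, and let $\nabla$ denote the Cartan connection. Then: (a) If a $\pi$-tensor field $W$ of type $(1,p)$ is conformally invariant, then its trace $\mathrm{Tr}(W)$ is conformally invariant. (b) The map $\nabla_{\gamma\overline X}:\mathfrak X(\pi(M))\to\mathfrak X(\pi(M)):\overline Y\mapsto\nabla_{\gamma\overline X}\overline Y$ is conformally invariant. Consequently, if $W$ is a conformally invariant $\pi$-tensor field, then so is $\nabla_{\gamma\overline X}W$. (c) The vector $\pi$-form $\nabla\overline X:\mathfrak X(\pi(M))\to\mathfrak X(\pi(M)):\overline Y\mapsto\nabla_{\gamma\overline Y}\overline X$ is conformally invariant. (d) The mixed torsion $T$ (of type $(1,2)$) of the Cartan connection is conformally invariant. Consequently, $\nabla_{\gamma\overline X}C$ is conformally invariant. (e) The $\pi$-tensor $(dL\circ\gamma)/L$ is conformally invariant; equivalently, the tensor $d_JL/L$ is conformally invariant. (f) The angular metric tensor $\hbar(\overline X,\overline Y)=g(\overline X,\overline Y)-\frac1{L^2}g(\overline X,\overline\eta)g(\overline Y,\overline\eta)$ is conformally $\sigma$-invariant. (g) The tensor field $$\mathbb T(\overline X,\overline Y,\overline Z,\overline W)=(\nabla_{\gamma\overline X}T)(\overline Y,\overline Z,\overline W)+\mathfrak S_{\overline X,\overline Y,\overline Z,\overline W}\frac1{L^2}g(\overline X,\overline\eta)T(\overline Y,\overline Z,\overline W)$$ is conformally $\sigma$-invariant.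
   Context: $M$ is a smooth manifold of finite dimension $n$; $\mathcal T M\subset TM$ is the bundle of nonzero tangent vectors, $\pi:\mathcal TM\to M$; $\pi^{-1}(TM)\to\mathcal TM$ is the pullback of $TM$ by $\pi$; $\mathfrak X(\pi(M))$ is the set of its smooth sections ($\pi$-vector fields); $\pi$-tensor fields are tensor fields on this bundle. $\overline\eta(u)=(u,u)$. $\gamma:\pi^{-1}(TM)\to T(\mathcal TM)$ is the vertical lift, $\rho:T(\mathcal TM)\to\pi^{-1}(TM)$ is $\rho=(\pi_{\mathcal TM},d\pi)$; $J:=\gamma\circ\rho$, $\mathcal C:=\gamma\circ\overline\eta$; $d_JL(X)=dL(JX)$. All identities are over $\mathcal TM$. For a linear connection $\nabla$ in $\pi^{-1}(TM)$ the deflection map is $K(X)=\nabla_X\overline\eta$; $\nabla$ is regular if $T(\mathcal TM)=\ker\rho\oplus\ker K$; then $\beta:=(\rho|_{\ker K})^{-1}$. Its torsion is $\mathbf T(X,Y)=\nabla_X\rho Y-\nabla_Y\rho X-\rho[X,Y]$, with $Q(\overline X,\overline Y)=\mathbf T(\beta\overline X,\beta\overline Y)$ and mixed torsion $T(\overline X,\overline Y)=\mathbf T(\gamma\overline X,\beta\overline Y)$. A Finsler manifold $(M,L)$: $L:TM\to\mathbb R$, $L\ge0$, $L(0)=0$, $L$ is $C^\infty$ on $\mathcal TM$, $C^1$ on $TM$, $\mathcal C\cdot L=L$, and $g$ with components $g_{ij}=\frac12\dot\partial_i\dot\partial_jL^2$ ($\dot\partial_i=\partial/\partial y^i$) is positive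 definite; $g$ is a metric in $\pi^{-1}(TM)$. The Cartan connection of $(M,L)$ is the unique regular connection with $\nabla g=0$, $Q=0$, $g(T(\overline X,\overline Y),\overline Z)=g(T(\overline X,\overline Z),\overline Y)$. The same letter $T$ denotes the $(0,3)$ tensor $T(\overline X,\overline Y,\overline Z)=g(T(\overline X,\overline Y),\overline Z)$; this is the $T$ used in (g). $C(\overline X)$ is the trace of $\overline Y\mapsto T(\overline X,\overline Y)$. $\mathfrak S$ denotes the cyclic sum over the indicated arguments. $\sigma$ is a smooth function on $M$. An object $W$ attached to Finsler structures, with $\tilde W$ the corresponding object of $(M,\tilde L)$, is conformally invariant if $\tilde W=W$ and conformally $\sigma$-invariant if $\tilde W=e^{2\sigma(x)}W$. $\mathrm{Tr}$ of a tensor of type $(1,p)$ is the contraction of its contravariant slot with a covariant slot. *)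

(* Defs.v *)
From HB Require Import structures.
From mathcomp Require Import all_boot all_order all_algebra.
From mathcomp Require Import all_classical all_reals all_analysis.
Set Implicit Arguments.
Unset Strict Implicit.
Unset Printing Implicit Defensive.
Import Order.TTheory GRing.Theory Num.Theory.
Import numFieldNormedType.Exports.
Local Open Scope classical_set_scope.
Local Open Scope ring_scope.

(** * Differentiable functions on an open subset of a normed space *)

Section Smooth.
Context {R : realType}.

(* C^k on [U]; only meaningful when [U] is open. *)
Fixpoint Ck (k : nat) (V W : normedModType R) (U : set V) (f : V -> W) : Prop :=
  match k with
  | 0 => forall x, U x -> {for x, continuous f}
  | k'.+1 => (forall x, U x -> differentiable f x)
             /\ (forall v : V, Ck k' U (fun x => 'D_v f x))
  end.

Definition smooth_on (V W : normedModType R) (U : set V) (f : V -> W) : Prop :=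
  forall k, Ck k U f.

End Smooth.

(** * Manifolds *)

(* A set with charts valued in [E]. [param i] is the inverse of [coord i] on
   [coord i @` dom i], and arbitrary outside. Every point has a preferred chart
   [chart_at p], and the tangent space at [p] is [E]: a tangent vector is given
   by its components in the chart [chart_at p] (the components in any other
   chart are obtained with [coord_change]). *)
Record charted (R : realType) (E : normedModType R) := Charted {
  point_of :> Type ;
  chart : Type ;
  dom : chart -> set point_of ;
  coord : chart -> point_of -> E ;
  param : chart -> E -> point_of ;
  chart_at : point_of -> chart
}.
Arguments dom {R E} N i p : rename.
Arguments coord {R E} N i p : rename.
Arguments param {R E} N i z : rename.
Arguments chart_at {R E} N p : rename.

Section Charted.
Context {R : realType} {E : normedModType R}.
Variable N : charted E.
Implicit Types (i j : chart N) (p : N) (A B : set N).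

(* The part of [coord i @` dom i] corresponding to [A]. *)
Definition cimage i A : set E := coord N i @` (dom N i `&` A).

Definition mopen A : Prop := forall i, open (cimage i A).

Definition smooth_manifold : Prop :=
  [/\ (forall p, dom N (chart_at N p) p),
      (forall i p, dom N i p -> param N i (coord N i p) = p),
      (forall i j, open (cimage i (dom N j)) /\
         smooth_on (cimage i (dom N j)) (coord N j \o param N i)),
      (forall p q : N, p <> q ->
         exists A B : set N, [/\ mopen A, mopen B, A p, B q & A `&` B = set0]) &
      (exists S : set (chart N),
         countable S /\ forall p, exists2 i, S i & dom N i p)].

(* Components in the chart [j] of the tangent vector at [p] whose components
   in the chart [i] are [v]. *)
Definition coord_change i j p (v : E) : E :=
  'D_v (coord N j \o param N i) (coord N i p).

(* Action of the tangent vector [v] at [p] on [f], i.e. df(v). *)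
Definition act (f : N -> R) p (v : E) : R :=
  'D_v (f \o param N (chart_at N p)) (coord N (chart_at N p) p).

Definition Ck_fun (k : nat) A (f : N -> R) : Prop :=
  forall i, Ck k (cimage i A) (f \o param N i).

Definition smooth_fun A (f : N -> R) : Prop := forall k, Ck_fun k A f.

(* Components in the chart [i] of a vector field. *)
Definition vf_rep (X : N -> E) i (z : E) : E :=
  let p := param N i z in coord_change (chart_at N p) i p (X p).

Definition smooth_vf A (X : N -> E) : Prop :=
  forall i, smooth_on (cimage i A) (vf_rep X i).

End Charted.

Section TangentMap.
Context {R : realType} {E F : normedModType R}.

Definition tangent_map (N : charted E) (P : charted F) (f : N -> P) (p : N)
    (v : E) : F :=
  'D_v (coord P (chart_at P (f p)) \o f \o param N (chart_at N p))
       (coord N (chart_at N p) p).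

End TangentMap.

(** * The tangent bundle and the bundle pi^-1(TM) *)

Section TangentBundle.
Context {R : realType} {n : nat}.
Let E : normedModType R := 'rV[R]_n.
Variable M : charted E.

(* The tangent bundle with its induced charts (x, y). *)
Definition TM : charted (E * E)%type :=
  @Charted R (E * E)%type (M * E)%type (chart M)
    (fun i => [set u | dom M i u.1])
    (fun i u => (coord M i u.1, coord_change (chart_at M u.1) i u.1 u.2))
    (fun i z => let p := param M i z.1 in
                (p, coord_change i (chart_at M p) p z.2))
    (fun u => chart_at M u.1).

Definition proj (u : TM) : M := u.1.

Definition slit : set TM := [set u | u.2 != 0].

(* All the objects below live over the slit bundle; the maps on [TM]
   representing them are arbitrary outside [slit]. The fibre of pi^-1(TM) at
   [u] is the tangent space of [M] at [proj u], i.e. [E]. *)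
Definition pi_field := TM -> E.
Definition vfield := TM -> (E * E)%type.

(* Components of a pi-vector field in the chart [i]. *)
Definition sec_rep (Y : pi_field) (i : chart M) (z : (E * E)%type) : E :=
  let u := param TM i z in coord_change (chart_at M u.1) i u.1 (Y u).

Definition smooth_sec (Y : pi_field) : Prop :=
  forall i, smooth_on (cimage (N := TM) i slit) (sec_rep Y i).

Definition eta : pi_field := fun u => u.2.

(* The vertical lift: the velocity of t |-> u + t x in the fibre. *)
Definition gamma (u : TM) (x : E) : (E * E)%type :=
  derive1 (fun t : R => coord TM (chart_at TM u) (u.1, u.2 + t *: x)) 0.

Definition rho (u : TM) (v : (E * E)%type) : E := tangent_map (P := M) proj u v.

Definition Jmap (u : TM) (v : (E * E)%type) : (E * E)%type := gamma u (rho u v).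

Definition gammaf (Y : pi_field) : vfield := fun u => gamma u (Y u).
Definition rhof (X : vfield) : pi_field := fun u => rho u (X u).
Definition Liouville : vfield := gammaf eta.

(* [X, Y]^a = X^b d_b Y^a - Y^b d_b X^a, the x- and y-components apart. *)
Definition lie_bracket (X Y : vfield) : vfield := fun u =>
  let i := chart_at TM u in
  let z := coord TM i u in
  let Xi := vf_rep X i in
  let Yi := vf_rep Y i in
  ('D_(Xi z) (fst \o Yi) z - 'D_(Yi z) (fst \o Xi) z,
   'D_(Xi z) (snd \o Yi) z - 'D_(Yi z) (snd \o Xi) z).

(** * Linear connections in pi^-1(TM) *)

(* [nabla u v Y] is the covariant derivative of the pi-vector field [Y] along
   the tangent vector [v] at [u]. *)
Definition conn := forall u : TM, (E * E)%type -> pi_field -> E.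

Definition linear_connection (nabla : conn) : Prop :=
  [/\ (forall u Y (a : R) v w, slit u -> smooth_sec Y ->
         nabla u (a *: v + w) Y = a *: nabla u v Y + nabla u w Y),
      (forall u v Y Z, slit u -> smooth_sec Y -> smooth_sec Z ->
         nabla u v (fun u' => Y u' + Z u') = nabla u v Y + nabla u v Z),
      (forall u v (f : TM -> R) Y, slit u -> smooth_fun slit f -> smooth_sec Y ->
         nabla u v (fun u' => f u' *: Y u')
         = act f u v *: Y u + f u *: nabla u v Y) &
      (forall X Y, smooth_vf slit X -> smooth_sec Y ->
         smooth_sec (fun u => nabla u (X u) Y))].

Definition deflection (nabla : conn) (u : TM) (v : (E * E)%type) : E :=
  nabla u v eta.

Definition regular (nabla : conn) : Prop :=
  forall u, slit u -> forall v : (E * E)%type,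
    exists! w : (E * E) * (E * E),
      [/\ rho u w.1 = 0, deflection nabla u w.2 = 0 & v = w.1 + w.2].

Definition beta (nabla : conn) (u : TM) (x : E) : (E * E)%type :=
  xget 0 [set v | deflection nabla u v = 0 /\ rho u v = x].

Definition betaf (nabla : conn) (Y : pi_field) : vfield :=
  fun u => beta nabla u (Y u).

Definition torsion (nabla : conn) (X Y : vfield) : pi_field := fun u =>
  nabla u (X u) (rhof Y) - nabla u (Y u) (rhof X) - rho u (lie_bracket X Y u).

Definition hh_torsion (nabla : conn) (X Y : pi_field) : pi_field :=
  torsion nabla (betaf nabla X) (betaf nabla Y).

Definition mixed_torsion (nabla : conn) (X Y : pi_field) : pi_field :=
  torsion nabla (gammaf X) (betaf nabla Y).

(** * pi-tensor fields *)

(* A pi-vector field through the vector [x] at [u]; the value at [u] of a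
   tensorial expression in pi-vector fields does not depend on this choice. *)
Definition ext (u : TM) (x : E) : pi_field :=
  xget (fun=> 0) [set Y : pi_field | smooth_sec Y /\ Y u = x].

Definition mixed_tensor (nabla : conn) (u : TM) (x y : E) : E :=
  mixed_torsion nabla (ext u x) (ext u y) u.

Definition pairing (x : E) (a : 'cV[R]_n) : R := (x *m a) 0 0.

(* The coordinate frame and coframe of pi^-1(TM) in the chart [i]. *)
Definition frame (i : chart M) (u : TM) (k : 'I_n) : E :=
  coord_change i (chart_at M u.1) u.1 (delta_mx 0 k).

Definition coframe (i : chart M) (u : TM) (k : 'I_n) : 'cV[R]_n :=
  \col_l coord_change (chart_at M u.1) i u.1 (delta_mx 0 l) 0 k.

Definition pi_form := TM -> 'cV[R]_n.

Definition smooth_form (a : pi_form) : Prop :=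
  forall i k, smooth_on (cimage (N := TM) i slit)
    ((fun u : TM => pairing (frame i u k) (a u)) \o param TM i).

Definition upd (I : eqType) (T : Type) (f : I -> T) (k : I) (x : T) : I -> T :=
  fun j => if j == k then x else f j.

(* Contravariant order [r] and covariant order [s], as a multilinear function
   of [r] covectors and [s] vectors in each fibre. *)
Definition ptensor (r s : nat) :=
  TM -> ('I_r -> 'cV[R]_n) -> ('I_s -> E) -> R.

Definition is_ptensor (r s : nat) (W : ptensor r s) : Prop :=
  [/\ (forall u a y k (c : R) b b', slit u ->
         W u (upd a k (c *: b + b')) y
         = c * W u (upd a k b) y + W u (upd a k b') y),
      (forall u a y k (c : R) x x', slit u ->
         W u a (upd y k (c *: x + x'))
         = c * W u a (upd y k x) + W u a (upd y k x')) &
      (forall i (p : 'I_r -> 'I_n) (q : 'I_s -> 'I_n),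
         smooth_on (cimage (N := TM) i slit)
           ((fun u : TM => W u (coframe i u \o p) (frame i u \o q))
              \o param TM i))].

(* Contraction of the contravariant slot with the covariant slot [k]. *)
Definition Tr (s : nat) (k : 'I_s.+1) (W : ptensor 1 s.+1) : ptensor 0 s :=
  fun u _ y =>
    \sum_(l < n) W u (fun _ => delta_mx l 0)
      (fun j => if unlift k j is Some j' then y j' else delta_mx 0 l).

Definition cov_form (nabla : conn) (u : TM) (v : (E * E)%type) (a : pi_form) :
    'cV[R]_n :=
  \col_l (let Y := ext u (delta_mx 0 l) in
          act (fun u' : TM => pairing (Y u') (a u')) u v
          - pairing (nabla u v Y) (a u)).

(* (nabla_v W)(a_1, ..., a_r, Y_1, ..., Y_s) at [u] *)
Definition cov_tensor (nabla : conn) (r s : nat) (u : TM) (v : (E * E)%type)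
    (W : ptensor r s) (a : 'I_r -> pi_form) (Y : 'I_s -> pi_field) : R :=
  act (fun u' : TM => W u' (fun k => a k u') (fun k => Y k u')) u v
  - \sum_(k < r) W u (upd (fun j => a j u) k (cov_form nabla u v (a k)))
                     (fun j => Y j u)
  - \sum_(k < s) W u (fun j => a j u)
                     (upd (fun j => Y j u) k (nabla u v (Y k))).

(** * Finsler manifolds and the Cartan connection *)

Definition metric_mx (L : TM -> R) (u : TM) : 'M[R]_n :=
  \matrix_(i, j)
    (2^-1 * 'D_(delta_mx 0 i)
              (fun w : E => 'D_(delta_mx 0 j) (fun w' : E => L (u.1, w') ^+ 2) w)
              u.2).

Definition metric (L : TM -> R) (u : TM) (x y : E) : R :=
  (x *m metric_mx L u *m y^T) 0 0.

(* If n > 0, a function of class C^1 on [TM] which is nonnegative, 1-homogeneous and has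
   a positive definite [g] does not exist, as it would be linear on the fibres;
   the regularity required along the zero section is the usual one, namely
   continuity of [L] and class C^1 for [L ^+ 2]. *)
Definition finsler (L : TM -> R) : Prop :=
  [/\ (forall u, 0 <= L u) /\ (forall p : M, L (p, 0) = 0),
      smooth_fun slit L,
      Ck_fun 0 setT L /\ Ck_fun 1 setT (fun u : TM => L u ^+ 2),
      (forall u, slit u -> act L u (Liouville u) = L u) &
      (forall u (x : E), slit u -> x != 0 -> 0 < metric L u x x)].

Definition cartan_connection (L : TM -> R) (nabla : conn) : Prop :=
  [/\ linear_connection nabla /\ regular nabla,
      (forall u v Y Z, slit u -> smooth_sec Y -> smooth_sec Z ->
         act (fun u' : TM => metric L u' (Y u') (Z u')) u v
         = metric L u (nabla u v Y) (Z u) + metric L u (Y u) (nabla u v Z)),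
      (forall X Y u, slit u -> smooth_sec X -> smooth_sec Y ->
         hh_torsion nabla X Y u = 0) &
      (forall X Y Z u, slit u -> smooth_sec X -> smooth_sec Y -> smooth_sec Z ->
         metric L u (mixed_torsion nabla X Y u) (Z u)
         = metric L u (mixed_torsion nabla X Z u) (Y u))].

(* C(X), of type (0,1). *)
Definition torsion_trace (nabla : conn) : ptensor 0 1 := fun u _ x =>
  \tr (lin1_mx (mixed_tensor nabla u (x ord0))).

(* T(X, Y, Z) = g(T(X, Y), Z), of type (0,3). *)
Definition torsion03 (L : TM -> R) (nabla : conn) : ptensor 0 3 := fun u _ x =>
  metric L u (mixed_tensor nabla u (x (inord 0)) (x (inord 1))) (x (inord 2)).

Definition angular_metric (L : TM -> R) (u : TM) (x y : E) : R :=
  metric L u x y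
  - (L u ^+ 2)^-1 * metric L u x (eta u) * metric L u y (eta u).

Definition args3 (T : Type) (x y z : T) : 'I_3 -> T := tnth [tuple x; y; z].

Definition no_arg (T : Type) : 'I_0 -> T := tnth [tuple].

Definition TTsummand (L : TM -> R) (nabla : conn) (X Y Z W : pi_field) (u : TM) :
    R :=
  (L u ^+ 2)^-1 * metric L u (X u) (eta u)
  * torsion03 L nabla u (@no_arg _) (args3 (Y u) (Z u) (W u)).

Definition TTtensor (L : TM -> R) (nabla : conn) (X Y Z W : pi_field) (u : TM) :
    R :=
  cov_tensor nabla u (gamma u (X u)) (torsion03 L nabla)
    (@no_arg _) (args3 Y Z W)
  + (TTsummand L nabla X Y Z W u + TTsummand L nabla Y Z W X u
     + TTsummand L nabla Z W X Y u + TTsummand L nabla W X Y Z u).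

(** * Conformal invariance *)

(* [W] and [W'] are the objects attached to the two Finsler structures. *)
Definition conf_invariant (V : Type) (W W' : TM -> V) : Prop :=
  forall u, slit u -> W' u = W u.

Definition conf_sigma_invariant (sigma : M -> R) (W W' : TM -> R) : Prop :=
  forall u, slit u -> W' u = expR (2 * sigma (proj u)) * W u.

Definition conformal (sigma : M -> R) (L L' : TM -> R) : Prop :=
  forall x y : E,
    conf_sigma_invariant sigma (fun u => metric L u x y)
                               (fun u => metric L' u x y).

End TangentBundle.

Arguments TM {R n} M.
Arguments slit {R n} M _.
Arguments pi_field {R n} M.
Arguments conn {R n} M.
Arguments pi_form {R n} M.
Arguments ptensor {R n} M r s.

(* Main.v *)
From Pilot Require Import Defs.
From HB Require Import structures.
From mathcomp Require Import all_boot all_order all_algebra.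
From mathcomp Require Import all_classical all_reals all_analysis.
Set Implicit Arguments.
Unset Strict Implicit.
Unset Printing Implicit Defensive.
Import Order.TTheory GRing.Theory Num.Theory.
Import numFieldNormedType.Exports.
Import Pilot.Defs.
Local Open Scope classical_set_scope.
Local Open Scope ring_scope.

(** All seven claims come down to two facts, valid over the nonzero vectors:
    L' = e^sigma L, and the two Cartan connections have the same vertical
    covariant derivatives.

    The first one is Euler's theorem on homogeneous functions. As L is
    homogeneous of degree 1, g(eta, eta) = L^2 ([euler_hessian], [metric_eta]),
    so g' = e^(2 sigma) g gives L'^2 = e^(2 sigma) L^2, and L, L' are
    nonnegative. The functions of the base point are constants for vertical
    derivatives ([act_gamma_scale]), hence d_J L' = e^sigma d_J L, which is (e);
    and (f) is a substitution.

    The second one is [vertical_invariant]. In a chart, the base component of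
    the bracket of gamma X and beta Y is the derivative of the components of Y
    in the vertical direction X, so that the mixed torsion is
      T(X, Y) = nabla_(gamma X) Y - (that derivative)       ([mixed_torsionE]),
    where the last term is the same for all regular connections. Let
    S Y = nabla'_(gamma X) Y - nabla_(gamma X) Y = T'(X, Y) - T(X, Y). Since
    e^(2 sigma) is constant along the fibres, the compatibility of both
    connections with their metrics gives g(S Y, Z) + g(Y, S Z) = 0, and the
    symmetry of both torsions gives g(S Y, Z) = g(S Z, Y). Together,
    g(S Y, Z) = - g(Z, S Y) for all sections Z; using this for
    Z = nabla'_(gamma X) Y and for Z = nabla_(gamma X) Y and subtracting, we
    reach g(S Y, S Y) = - g(S Y, S Y), so S Y = 0 as g is positive definite.
    Taking these two sections for Z replaces the extension of the vector
    (S Y)(u) to a global section.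

    This is (b) for fields, (c), and the invariance of T in (d). For tensors,
    if W' = c W with c a function on M, then the vertical covariant derivatives
    of W' and W are in the same ratio ([cov_tensor_scale]): c = 1 gives the rest
    of (b) and (d), and c = e^(2 sigma) applied to T(X, Y, Z) gives (g). *)

(** * Directional derivatives and smooth maps *)

Section Derivatives.
Context {R : realType}.
Implicit Types U V W : normedModType R.

(** A directional derivative only sees the restriction of the map to a line, so
    it can be moved between different ambient spaces. *)
Lemma derive_along_line V V' W (f : V -> W) (g : V' -> W) a v b w :
  (forall h : R, f (h *: v + a) = g (h *: w + b)) -> 'D_v f a = 'D_w g b.
Proof.
move=> fg; rewrite /derive; congr (lim (_ @ 0^')); apply/funext => h /=.
by rewrite fg; have := fg 0; rewrite !scale0r !add0r => ->.
Qed.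

(** When c is nonzero, f is derivable if and only if c f is; if they are not, both
    derivatives have the default value 0. *)
Lemma derive_scale V (f : V -> R) (c : R) a v :
  'D_v (fun x => c * f x) a = c * 'D_v f a.
Proof.
have [->|c0] := eqVneq c 0.
  rewrite mul0r -[RHS](derive_cst (0 : R) a v).
  by congr ('D_v _ a); apply/funext => x; rewrite mul0r.
have [df|ndf] := pselect (derivable f a v).
  by rewrite -[LHS]/('D_v (c \*: f) a) deriveZ.
have ndcf : ~ derivable (c \*: f) a v.
  move=> dcf; apply: ndf.
  rewrite (_ : f = c^-1 \*: (c \*: f)); first exact: derivableZ.
  by apply/funext => x; rewrite /= !/GRing.scale/= mulKf.
by rewrite /derive (dvgP ndf) (dvgP ndcf) /point /= mulr0.
Qed.

Lemma derive_linearP V W (f : V -> W) a (c : R) v w :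
  differentiable f a -> 'D_(c *: v + w) f a = c *: 'D_v f a + 'D_w f a.
Proof. by move=> df; rewrite !(deriveE _ df) linearP. Qed.

Lemma derive_chain U V W (g : U -> V) (f : V -> W) a v :
  differentiable g a -> differentiable f (g a) ->
  'D_v (f \o g) a = 'D_('D_v g a) f (g a).
Proof.
move=> dg df; have dfg := differentiable_comp dg df.
by rewrite (deriveE _ dfg) (deriveE _ dg) (deriveE _ df) diff_comp.
Qed.

Lemma derive_pair U V W (f : U -> V) (g : U -> W) a v :
  differentiable f a -> differentiable g a ->
  'D_v (fun x => (f x, g x)) a = ('D_v f a, 'D_v g a).
Proof.
move=> df dg; have dfg := differentiable_pair df dg.
by rewrite (deriveE _ dfg) (deriveE _ dg) (deriveE _ df) diff_pair.
Qed.

Lemma near_eq_differentiable V W (f g : V -> W) a :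
  (\near a, f a = g a) -> differentiable f a -> differentiable g a.
Proof.
move=> fg /diff_locallyP[dfC fE].
have gE : g \o shift a = cst (g a) + 'd f a +o_ (0 : V) id.
  apply/eqaddoP => e e0; move/eqaddoP : fE => /(_ e e0).
  have fg0 : \forall h \near (0 : V), f (h + a) = g (h + a).
    by move: (fg); rewrite (near_shift 0) subr0.
  apply: filterS2 fg0 => h /= fgh.
  by rewrite !fctE /= (nbhs_singleton fg) fgh.
by apply/diff_locallyP; rewrite (diff_unique dfC gE); split.
Qed.

Lemma near_of_open V (A : set V) (P : V -> Prop) a :
  open A -> A a -> (forall x, A x -> P x) -> \near a, P a.
Proof.
by move=> oA Aa AP; apply: filterS (open_nbhs_nbhs (conj oA Aa)).
Qed.

Lemma Ck_eq_on V W k (A : set V) (f g : V -> W) :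
  open A -> (forall x, A x -> f x = g x) -> Ck k A f -> Ck k A g.
Proof.
move=> oA; elim: k f g => [|k IH] f g fg /=.
  move=> cf x Ax; have fx : f @ x --> f x by exact: cf.
  have gx : g @ x --> g x.
    rewrite -fg//; apply: cvg_trans fx; apply: near_eq_cvg.
    exact: near_of_open oA Ax fg.
  exact: gx.
move=> [df Df]; split=> [x Ax|v].
  by apply: near_eq_differentiable (df x Ax); exact: near_of_open oA Ax fg.
apply: IH (Df v) => x Ax; apply: near_eq_derive; exact: near_of_open oA Ax fg.
Qed.

Lemma smooth_on_eq V W (A : set V) (f g : V -> W) :
  open A -> (forall x, A x -> f x = g x) -> smooth_on A f -> smooth_on A g.
Proof. by move=> oA fg sf k; exact: Ck_eq_on oA fg (sf k). Qed.

Lemma smooth_on_cst V W (A : set V) (c : W) : smooth_on A (fun=> c).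
Proof.
move=> k; elim: k c => [|k IH] c /=; first by move=> x _; exact: cst_continuous.
split=> [x _|v]; first exact: differentiable_cst.
have -> : (fun x => 'D_v (fun=> c) x) = (fun=> 0) :> (V -> W).
  by apply/funext => x; exact: derive_cst.
exact: IH.
Qed.

(** Read in a chart, a vertical vector field has this form. *)
Lemma smooth_on_pair0 V W W' (A : set V) (f : V -> W) :
  open A -> smooth_on A f -> smooth_on A (fun x => (0 : W', f x)).
Proof.
move=> oA sf k; elim: k f {sf}(sf k) => [|k IH] f /=.
  by move=> cf x Ax; apply: cvg_pair; [exact: cvg_cst|exact: cf].
move=> [df Df]; split=> [x Ax|v].
  by apply: differentiable_pair; [exact: differentiable_cst|exact: df].
have IHv := IH _ (Df v); apply: Ck_eq_on IHv => // x Ax.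
rewrite derive_pair ?derive_cst//; exact: df.
Qed.

Lemma scale_is_bilinear W :
  bilinear_for (GRing.Scale.Law.clone _ _ *:%R _) (GRing.Scale.Law.clone _ _ *:%R _)
  (@GRing.scale R W : R^o -> W -> W).
Proof.
split=> [w a x y|x a v w] /=.
  by rewrite scalerDl scalerA.
by rewrite scalerDr !scalerA mulrC.
Qed.

Lemma differentiable_scale V W (k : V -> R) (f : V -> W) a :
  differentiable k a -> differentiable f a ->
  differentiable (fun x => k x *: f x) a.
Proof.
move=> dk df.
pose bm := bilinear_isBilinear.Build R R^o W W _ _
  (@GRing.scale R W : R^o -> W -> W) (scale_is_bilinear W).
pose b : {bilinear R^o -> W -> W} :=
  HB.pack (@GRing.scale R W : R^o -> W -> W) bm.
have cb : continuous (fun p : R^o * W => b p.1 p.2) by exact: scale_continuous.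
have db := @differentiable_bilin _ _ _ _ b (k a, f a) cb.
exact: differentiable_comp (differentiable_pair dk df) db.
Qed.

Lemma differentiable_fst V W (z : V * W) :
  differentiable (fst : V * W -> V) z.
Proof.
have lin : linear (fst : V * W -> V) by [].
pose l : {linear (V * W)%type -> V} :=
  HB.pack (fst : V * W -> V) (GRing.isLinear.Build _ _ _ _ _ lin).
by apply: (@linear_differentiable _ _ _ l) => w; exact: cvg_fst.
Qed.

Lemma differentiable_snd V W (z : V * W) :
  differentiable (snd : V * W -> W) z.
Proof.
have lin : linear (snd : V * W -> W) by [].
pose l : {linear (V * W)%type -> W} :=
  HB.pack (snd : V * W -> W) (GRing.isLinear.Build _ _ _ _ _ lin).
by apply: (@linear_differentiable _ _ _ l) => w; exact: cvg_snd.
Qed.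

Lemma open_neq0 V : open [set w : V | w != 0].
Proof.
rewrite (_ : [set w | _] = ~` [set 0]); last first.
  by apply/seteqP; split=> w /= /eqP.
apply: closed_openC; apply: accessible_closed_set1.
exact/hausdorff_accessible/norm_hausdorff.
Qed.

Lemma near_neq0 V (P : V -> Prop) w :
  w != 0 -> (forall w, w != 0 -> P w) -> \near w, P w.
Proof. by move=> w0 HP; apply: near_of_open (open_neq0 _) w0 HP. Qed.

Lemma derive_basis_sum n W (f : 'rV[R]_n -> W) a (v : 'rV[R]_n) :
  differentiable f a ->
  'D_v f a = \sum_i v 0 i *: 'D_(delta_mx 0 i) f a.
Proof.
move=> df; rewrite deriveE// {1}(row_sum_delta v) linear_sum.
by apply: eq_bigr => i _; rewrite linearZ deriveE.
Qed.

End Derivatives.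

(** * Euler's theorem *)

Section Euler.
Context {R : realType}.

(** The hypothesis on [f] is Euler's relation for degree 1. On the ray through [y],
    with phi(t) = f(t y) and psi = phi', it says t psi(t) = phi(t); at t = 1, the
    derivative of this relation is psi'(1) + psi(1) = psi(1). *)
Lemma homogeneous_derive_radial (V : normedModType R) (f : V -> R) y :
  (forall w : V, w != 0 -> differentiable f w) ->
  (forall w : V, w != 0 -> differentiable (fun w => 'D_y f w) w) ->
  (forall w : V, w != 0 -> 'D_w f w = f w) ->
  y != 0 -> 'D_y (fun w => 'D_y f w) y = 0.
Proof.
move=> df d2f fE y0.
pose phi (t : R) := f (t *: y); pose psi (t : R) := 'D_y f (t *: y).
have dline (t : R) : differentiable (fun t : R => t *: y) t.
  by apply: differentiableZl; exact: ex_diff.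
have y1 : (1 : R) *: y = y by rewrite scale1r.
have hE (h : R) : h *: (1 : R) + 1 = h + 1 by rewrite /GRing.scale /= mulr1.
have dphi : differentiable phi (1 : R).
  apply: (differentiable_comp (f := fun t : R => t *: y)); rewrite ?y1.
    exact: dline.
  exact: df.
have dpsi : differentiable psi (1 : R).
  apply: (differentiable_comp (f := fun t : R => t *: y)
    (g := fun w => 'D_y f w)); rewrite ?y1.
    exact: dline.
  exact: d2f.
have phi' : 'D_(1 : R) phi (1 : R) = 'D_y f y.
  by apply: derive_along_line => h; rewrite /phi hE scalerDl scale1r.
have psi' : 'D_(1 : R) psi (1 : R) = 'D_y (fun w => 'D_y f w) y.
  by apply: derive_along_line => h; rewrite /psi hE scalerDl scale1r.
have tpsi : \forall t \near (1 : R), (id * psi) t = phi t.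
  have := open_neq0 R^o => o0.
  apply: near_of_open o0 (oner_neq0 _) _ => t t0.
  have ty0 : t *: y != 0 by rewrite scaler_eq0 negb_or t0.
  transitivity ('D_(t *: y) f (t *: y)); last exact: fE.
  by have := derive_linearP t y 0 (df _ ty0); rewrite !addr0 derive0 addr0 => ->.
have dM : 'D_(1 : R) (id * psi) (1 : R) = 'D_y (fun w => 'D_y f w) y + 'D_y f y.
  have did : derivable (id : R -> R) (1 : R) (1 : R) by exact: derivable_id.
  have dps : derivable psi (1 : R) (1 : R) by exact: diff_derivable.
  rewrite (deriveM did dps).
  by rewrite derive_id psi' /psi y1 /GRing.scale /= mul1r mulr1.
move: (near_eq_derive (1 : R) tpsi); rewrite dM phi' => /eqP.
by rewrite -subr_eq0 addrK => /eqP.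
Qed.

(** The left-hand side is g(y, y). By linearity of derivatives in their direction
    it is half the second derivative of f^2 at [y] along [y] itself, that is
    (D_y f)^2 + f D_y D_y f, where D_y f = f and D_y D_y f = 0. *)
Lemma euler_hessian n (f : 'rV[R]_n -> R) (y : 'rV[R]_n) :
  (forall w : 'rV[R]_n, w != 0 -> differentiable f w) ->
  (forall v w : 'rV[R]_n, w != 0 -> differentiable (fun w => 'D_v f w) w) ->
  (forall w : 'rV[R]_n, w != 0 -> 'D_w f w = f w) ->
  y != 0 ->
  (y *m (\matrix_(i, j) (2^-1 * 'D_(delta_mx 0 i)
      (fun w : 'rV[R]_n =>
         'D_(delta_mx 0 j) (fun w' : 'rV[R]_n => f w' ^+ 2) w) y))
    *m y^T) 0 0 = f y ^+ 2.
Proof.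
move=> df d2f fE y0.
have -> : (fun w : 'rV[R]_n => f w ^+ 2) = f * f by apply/funext => w.
pose F : 'rV[R]_n -> R := f * f; rewrite -/F.
have dF (w : 'rV[R]_n) : w != 0 -> differentiable F w.
  by move=> w0; apply: differentiableM; exact: df.
have DF (v w : 'rV[R]_n) : w != 0 -> 'D_v F w = 2 * (f w * 'D_v f w).
  move=> w0; have dfw : derivable f w v by exact/diff_derivable/df.
  by rewrite (deriveM dfw dfw) mulr_natl mulr2n.
have dfDf (v w : 'rV[R]_n) : w != 0 ->
    differentiable (f * (fun w => 'D_v f w)) w.
  by move=> w0; apply: differentiableM; [exact: df|exact: d2f].
have d2F (v w : 'rV[R]_n) : w != 0 -> differentiable (fun w => 'D_v F w) w.
  move=> w0.
  apply: (@near_eq_differentiable _ _ _ (2 \*: (f * (fun w => 'D_v f w)))).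
    by apply: near_neq0 => // w' /(DF v) ->.
  by apply: differentiableZ; exact: dfDf.
have DyyF : 'D_y (fun w => 'D_y F w) y = 2 * f y ^+ 2.
  rewrite (near_eq_derive _ (near_neq0 y0 (DF y))).
  rewrite derive_scale.
  have dfy : derivable f y y by exact/diff_derivable/df.
  have d2fy : derivable (fun w => 'D_y f w) y y by exact/diff_derivable/d2f.
  rewrite (deriveM dfy d2fy) homogeneous_derive_radial//; last exact: d2f.
  by rewrite scaler0 add0r fE.
have -> : f y ^+ 2 = 2^-1 * 'D_y (fun w => 'D_y F w) y.
  by rewrite DyyF mulKf.
transitivity (2^-1 * \sum_j y 0 j * 'D_y (fun w => 'D_(delta_mx 0 j) F w) y).
  rewrite mxE mulr_sumr; apply: eq_bigr => j _; rewrite !mxE mulrA.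
  rewrite (derive_basis_sum _ (d2F _ _ y0)) mulrC mulr_sumr mulr_sumr.
  apply: eq_bigr => i _.
  rewrite mxE /GRing.scale /= [RHS]mulrAC [RHS]mulrC; congr (_ * _).
  by rewrite mulrCA.
congr (_ * _); symmetry.
transitivity
    ('D_y (\sum_(j < n) (y 0 j \*: (fun w => 'D_(delta_mx 0 j) F w))) y).
  apply: near_eq_derive; apply: near_neq0 => // w w0.
  by rewrite derive_basis_sum ?fct_sumE//; exact: dF.
rewrite derive_sum; last by move=> j; apply: derivableZ; exact/diff_derivable/d2F.
by apply: eq_bigr => j _; rewrite deriveZ//; exact/diff_derivable/d2F.
Qed.

End Euler.

(** * Charts of a manifold and of its tangent bundle *)

Section Charts.
Context {R : realType} {n : nat}.
Variable M : charted 'rV[R]_n.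
Hypothesis manM : smooth_manifold M.
Implicit Types (i j k : chart M) (p q : M).

Lemma dom_chart_at p : dom M (chart_at M p) p.
Proof. by case: manM => H _ _ _ _; exact: H. Qed.

Lemma paramK i p : dom M i p -> param M i (coord M i p) = p.
Proof. by case: manM => _ H _ _ _; exact: H. Qed.

Lemma open_cimage_dom i j : open (cimage i (dom M j)).
Proof. by case: manM => _ _ H _ _; case: (H i j). Qed.

Lemma cimage_coord i (A : set M) p : dom M i p -> A p -> cimage i A (coord M i p).
Proof. by move=> ip Ap; exists p. Qed.

Lemma differentiable_transition i j z :
  cimage i (dom M j) z -> differentiable (coord M j \o param M i) z.
Proof.
by case: manM => _ _ H _ _ zij; case: (H i j) => _ /(_ 1%N)[df _]; exact: df.
Qed.

Lemma differentiable_derive_transition i j z v :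
  cimage i (dom M j) z ->
  differentiable (fun z => 'D_v (coord M j \o param M i) z) z.
Proof.
case: manM => _ _ H _ _ zij; case: (H i j) => _ /(_ 2%N)[_ /(_ v)[df _]].
exact: df.
Qed.

Lemma near_overlap i j p (P : 'rV[R]_n -> Prop) : dom M i p -> dom M j p ->
  (forall q, dom M i q -> dom M j q -> P (coord M i q)) ->
  \forall z \near coord M i p, P z.
Proof.
move=> ip jp HP.
apply: near_of_open (@open_cimage_dom i j) (cimage_coord ip jp) _.
by move=> _ [q [iq jq] <-]; exact: HP.
Qed.

Lemma coord_change_id i p v : dom M i p -> coord_change i i p v = v.
Proof.
move=> ip; rewrite /coord_change -[RHS](derive_id (coord M i p) v).
apply: near_eq_derive.
apply: (near_overlap ip ip) => q iq _.
by rewrite /= paramK.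
Qed.

(** The chain rule, applied to the cocycle relation of the transition maps. *)
Lemma coord_change_comp i j k p v :
  dom M i p -> dom M j p -> dom M k p ->
  coord_change j k p (coord_change i j p v) = coord_change i k p v.
Proof.
move=> ip jp kp.
have cj : (coord M j \o param M i) (coord M i p) = coord M j p.
  by rewrite /= paramK.
have dij := differentiable_transition (cimage_coord ip jp).
have djk := differentiable_transition (cimage_coord jp kp).
rewrite -cj in djk.
rewrite /coord_change -[in LHS]cj -derive_chain//.
apply: near_eq_derive; apply: (near_overlap ip jp) => q iq jq.
by rewrite /= paramK// paramK.
Qed.

Lemma coord_changeK i j p v : dom M i p -> dom M j p ->
  coord_change j i p (coord_change i j p v) = v.
Proof. by move=> ip jp; rewrite coord_change_comp// coord_change_id. Qed.

Lemma coord_change0 i j p : coord_change i j p 0 = 0.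
Proof. exact: derive0. Qed.

Lemma coord_change_eq0 i j p v : dom M i p -> dom M j p ->
  (coord_change i j p v == 0) = (v == 0).
Proof.
move=> ip jp; apply/eqP/eqP => [v0|->]; last exact: coord_change0.
by rewrite -(coord_changeK v ip jp) v0 coord_change0.
Qed.

Implicit Types u : TM M.

Lemma coord_chart_at u :
  coord (TM M) (chart_at (TM M) u) u = (coord M (chart_at M u.1) u.1, u.2).
Proof. by rewrite /= coord_change_id//; exact: dom_chart_at. Qed.

Lemma paramTMK i u : dom M i u.1 -> param (TM M) i (coord (TM M) i u) = u.
Proof.
move=> iu; rewrite /= paramK// coord_changeK//; first by case: u {iu}.
exact: dom_chart_at.
Qed.

Lemma param_chart_at p w :
  param (TM M) (chart_at M p) (coord M (chart_at M p) p, w) = (p, w).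
Proof.
have dp := dom_chart_at p.
by rewrite /= paramK// coord_change_id.
Qed.

(** Coordinate changes are invertible, so that the nonvanishing of a vector is read
    on its components in any chart. *)
Lemma cimage_slitE i :
  cimage (N := TM M) i (@slit R n M)
  = [set z | cimage i (dom M i) z.1 /\ z.2 != 0].
Proof.
apply/seteqP; split=> [_ [u [iu su] <-]|[z1 z2] /= [[q [iq _] <-] z0]].
  split; first exact: cimage_coord.
  by rewrite /= coord_change_eq0//; exact: dom_chart_at.
have dq := dom_chart_at q.
exists (q, coord_change i (chart_at M q) q z2); last by rewrite /= coord_changeK.
by split => //; rewrite /slit /= coord_change_eq0.
Qed.

Lemma open_cimage_slit i : open (cimage (N := TM M) i (@slit R n M)).
Proof.
rewrite cimage_slitE.
rewrite (_ : [set z | _] = (fst @^-1` (cimage i (dom M i)))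
                           `&` (snd @^-1` [set w | w != 0]))//.
apply: openI; apply: open_comp => //.
- by move=> z _; exact: cvg_fst.
- exact: open_cimage_dom.
- by move=> z _; exact: cvg_snd.
- exact: open_neq0.
Qed.

Lemma cimage_slit_chart_at u : slit M u ->
  cimage (N := TM M) (chart_at (TM M) u) (@slit R n M)
    (coord (TM M) (chart_at (TM M) u) u).
Proof. by move=> su; exists u => //; split=> //; exact: dom_chart_at. Qed.

(** The transition maps of TM are the tangent maps of those of M. *)
Lemma transition_TME i j z : cimage i (dom M j) z.1 ->
  (coord (TM M) j \o param (TM M) i) z
  = ((coord M j \o param M i) z.1, 'D_(z.2) (coord M j \o param M i) z.1).
Proof.
case: z => z1 z2 /= [q [iq jq] <-]; rewrite paramK// coord_change_comp//.
exact: dom_chart_at.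
Qed.

Lemma open_base_overlap i j :
  open [set z : 'rV[R]_n * 'rV[R]_n | cimage i (dom M j) z.1].
Proof.
apply: (@open_comp _ _ fst (cimage i (dom M j))); last exact: open_cimage_dom.
by move=> z _; exact: cvg_fst.
Qed.

Lemma differentiable_fibre_transition i j (z : 'rV[R]_n * 'rV[R]_n) :
  cimage i (dom M j) z.1 ->
  differentiable
    (fun z : 'rV[R]_n * 'rV[R]_n => 'D_(z.2) (coord M j \o param M i) z.1) z.
Proof.
move=> zij.
pose D l := fun z : 'rV[R]_n * 'rV[R]_n =>
  z.2 0 l *: 'D_(delta_mx 0 l) (coord M j \o param M i) z.1.
have dD : differentiable (\sum_(l < n) D l) z.
  apply: differentiable_sum => l; apply: differentiable_scale.
    apply: (differentiable_comp (g := fun w : 'rV[R]_n => w 0 l)).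
      exact: differentiable_snd.
    exact: differentiable_coord.
  apply: (differentiable_comp
    (g := fun w => 'D_(delta_mx 0 l) (coord M j \o param M i) w)).
    exact: differentiable_fst.
  exact: differentiable_derive_transition.
apply: near_eq_differentiable dD.
apply: near_of_open (@open_base_overlap i j) zij _ => w wij.
by rewrite fct_sumE -derive_basis_sum//; exact: differentiable_transition.
Qed.

Lemma differentiable_base_transition i j (z : 'rV[R]_n * 'rV[R]_n) :
  cimage i (dom M j) z.1 ->
  differentiable
    (fun z : 'rV[R]_n * 'rV[R]_n => (coord M j \o param M i) z.1) z.
Proof.
move=> zij; apply: (differentiable_comp (g := coord M j \o param M i)).
  exact: differentiable_fst.
exact: differentiable_transition.
Qed.

Lemma coord_change_TME i j u v : dom M i u.1 -> dom M j u.1 ->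
  let z := coord (TM M) i u in
  coord_change (N := TM M) i j u v =
  ('D_v (fun z : 'rV[R]_n * 'rV[R]_n => (coord M j \o param M i) z.1) z,
   'D_v (fun z : 'rV[R]_n * 'rV[R]_n =>
           'D_(z.2) (coord M j \o param M i) z.1) z).
Proof.
move=> iu ju z; have cu := cimage_coord iu ju.
have nE : \forall z \near coord (TM M) i u,
    (coord (TM M) j \o param (TM M) i) z
    = ((coord M j \o param M i) z.1, 'D_(z.2) (coord M j \o param M i) z.1).
  apply: near_of_open (@open_base_overlap i j) _ _ => // z' /=.
  exact: transition_TME.
rewrite /coord_change (near_eq_derive _ nE) derive_pair//.
- exact: differentiable_base_transition.
- exact: differentiable_fibre_transition.
Qed.

Lemma coord_change_TM_base i j u v : dom M i u.1 -> dom M j u.1 ->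
  (coord_change (N := TM M) i j u v).1 = coord_change i j u.1 v.1.
Proof.
move=> iu ju; rewrite (coord_change_TME _ iu ju) /=.
by apply: derive_along_line => h.
Qed.

Lemma coord_change_TM_vert i j u x : dom M i u.1 -> dom M j u.1 ->
  coord_change (N := TM M) i j u (0, x) = (0, coord_change i j u.1 x).
Proof.
move=> iu ju; rewrite (coord_change_TME _ iu ju) /=.
have cu := cimage_coord iu ju; congr pair.
  rewrite -[RHS](derive0 (coord M j \o param M i) (coord M i u.1)).
  by apply: derive_along_line => h.
(* Along the fibre the second component is affine. *)
rewrite -[RHS](derive_id ('D_(coord_change (chart_at M u.1) i u.1 u.2)
                 (coord M j \o param M i) (coord M i u.1))).
apply: derive_along_line => h /=; rewrite scaler0 add0r derive_linearP//.
exact: differentiable_transition.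
Qed.

Lemma gammaE u x : gamma u x = (0, x).
Proof.
rewrite /gamma derive1E.
rewrite -[RHS](derive_id (coord M (chart_at M u.1) u.1, u.2)).
apply: derive_along_line => h.
rewrite /= addr0 coord_change_id ?scaler0 ?add0r; last exact: dom_chart_at.
rewrite -[h *: 1]/(h * 1) mulr1; congr pair; last exact: addrC.
by rewrite /= scaler0 add0r.
Qed.

Lemma rhoE u v : rho u v = v.1.
Proof.
rewrite /rho /tangent_map coord_chart_at.
rewrite -[RHS](coord_change_id _ (dom_chart_at u.1)).
by apply: derive_along_line => h.
Qed.

End Charts.

(** * Connections along the fibres *)

Lemma vertical_line (R : realType) (V W : normedModType R) (h : R) (a : V)
    (v w : W) :
  h *: (0, v) + (a, w) = (a, h *: v + w).
Proof. by congr pair; rewrite /= scaler0 add0r. Qed.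

Section Fields.
Context {R : realType} {n : nat}.
Variable M : charted 'rV[R]_n.
Hypothesis manM : smooth_manifold M.
Implicit Types (i j k : chart M) (u : TM M) (X Y Z : pi_field M) (nabla : conn M).

Lemma near_slit u (P : 'rV[R]_n * 'rV[R]_n -> Prop) : slit M u ->
  (forall u', dom M (chart_at M u.1) u'.1 -> slit M u' ->
     P (coord (TM M) (chart_at (TM M) u) u')) ->
  \forall z \near coord (TM M) (chart_at (TM M) u) u, P z.
Proof.
move=> su HP.
have oS := @open_cimage_slit _ _ _ manM (chart_at (TM M) u).
apply: near_of_open oS (cimage_slit_chart_at manM su) _.
by move=> _ [u' [iu' su'] <-]; exact: HP.
Qed.

Lemma sec_repE Y i u : dom M i u.1 ->
  sec_rep Y i (coord (TM M) i u) = coord_change (chart_at M u.1) i u.1 (Y u).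
Proof. by move=> iu; rewrite /sec_rep paramTMK. Qed.

Lemma vf_rep_TME (X : vfield M) i u : dom M i u.1 ->
  vf_rep X i (coord (TM M) i u) = coord_change (N := TM M) (chart_at M u.1) i u (X u).
Proof. by move=> iu; rewrite /vf_rep paramTMK. Qed.

Lemma coord_change_gammaf X i u : dom M i u.1 ->
  coord_change (N := TM M) (chart_at M u.1) i u (gammaf X u)
  = (0, coord_change (chart_at M u.1) i u.1 (X u)).
Proof.
move=> iu; rewrite /gammaf (gammaE manM).
exact: (coord_change_TM_vert manM _ (dom_chart_at manM _) iu).
Qed.

Lemma smooth_sec_eq Y Y' : (forall u, slit M u -> Y u = Y' u) ->
  smooth_sec Y -> smooth_sec Y'.
Proof.
move=> YY' sY i; apply: smooth_on_eq (sY i); first exact: open_cimage_slit.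
move=> _ [u [iu su] <-]; rewrite (sec_repE Y iu) (sec_repE Y' iu).
by rewrite YY'.
Qed.

Lemma smooth_sec0 : smooth_sec ((fun=> 0) : pi_field M).
Proof.
move=> i; have := @smooth_on_cst R ('rV[R]_n * 'rV[R]_n)%type 'rV[R]_n
  (cimage (N := TM M) i (slit M)) 0.
apply: smooth_on_eq; first exact: open_cimage_slit.
by move=> _ [u [iu su] <-]; rewrite (sec_repE _ iu) coord_change0.
Qed.

(** If no section extends the vector, [ext] is the zero section. *)
Lemma smooth_ext u x : smooth_sec (ext u x).
Proof.
rewrite /ext; case: xgetP => [Y _ []//|_]; exact: smooth_sec0.
Qed.

Lemma smooth_gammaf X : smooth_sec X -> smooth_vf (slit M) (gammaf X).
Proof.
move=> sX i; have oS : open (cimage (N := TM M) i (slit M)).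
  exact: open_cimage_slit.
have := @smooth_on_pair0 _ _ _ 'rV[R]_n _ _ oS (sX i).
apply: smooth_on_eq => // _ [u [iu su] <-].
by rewrite (sec_repE _ iu) (vf_rep_TME _ iu) (coord_change_gammaf _ iu).
Qed.

Lemma act_eq_on_slit (F F' : TM M -> R) u v :
  (forall u, slit M u -> F u = F' u) -> slit M u -> act F u v = act F' u v.
Proof.
move=> FF' su; apply: near_eq_derive; apply: near_slit => // u' iu' su'.
by rewrite /comp (paramTMK manM iu') FF'.
Qed.

Lemma act_gamma (F : TM M -> R) u x :
  act F u (gamma u x) = 'D_x (fun w : 'rV[R]_n => F (u.1, w)) u.2.
Proof.
rewrite /act gammaE// coord_chart_at//; apply: derive_along_line => h.
by rewrite vertical_line /comp (param_chart_at manM).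
Qed.

(** A function of the base point is constant along the fibres. *)
Lemma act_gamma_scale (c : M -> R) (F F' : TM M -> R) u x : slit M u ->
  (forall u, slit M u -> F' u = c (proj u) * F u) ->
  act F' u (gamma u x) = c (proj u) * act F u (gamma u x).
Proof.
move=> su FF'; rewrite !act_gamma -derive_scale; apply: near_eq_derive.
by apply: near_neq0 => // w w0; rewrite FF'.
Qed.

Lemma smooth_indic_slit :
  smooth_fun (slit M) (fun u : TM M => (u.2 != 0)%:R : R).
Proof.
move=> k i; have := @smooth_on_cst R ('rV[R]_n * 'rV[R]_n)%type R
  (cimage (N := TM M) i (slit M)) 1 k.
apply: Ck_eq_on; first exact: open_cimage_slit.
by move=> _ [u [iu su] <-]; rewrite /comp (paramTMK manM iu) su.
Qed.

Section Connection.
Variable nabla : conn M.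
Hypothesis linC : linear_connection nabla.

(** Multiplying a section by the indicator function of the nonzero vectors erases
    its values on the zero section. This indicator is 1 on the slit bundle, which
    is open, so by the Leibniz rule the covariant derivatives over the slit bundle
    are unchanged. *)
Lemma conn_eq_on_slit Y Y' u v : (forall u, slit M u -> Y u = Y' u) ->
  smooth_sec Y -> slit M u -> nabla u v Y = nabla u v Y'.
Proof.
move=> YY' sY su; have sY' := smooth_sec_eq YY' sY.
pose f (u : TM M) : R := (u.2 != 0)%:R.
have fl Z : smooth_sec Z -> nabla u v (fun u => f u *: Z u) = nabla u v Z.
  move=> sZ; case: linC => _ _ /(_ u v f Z su smooth_indic_slit sZ) -> _.
  rewrite (_ : act f u v = 0) ?scale0r ?add0r ?/f ?su ?scale1r//.
  rewrite (@act_eq_on_slit _ (fun=> 1))//; first exact: derive_cst.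
  by move=> u' su'; rewrite su'.
rewrite -(fl Y)// -(fl Y')//; congr (nabla u v _); apply/funext => u'.
rewrite /f; case: (boolP (u'.2 == 0)) => [_|su']; first by rewrite !scale0r.
by rewrite YY'.
Qed.

Lemma conn0 u v : slit M u -> nabla u v (fun=> 0) = 0.
Proof.
move=> su; case: linC => _ /(_ u v _ _ su smooth_sec0 smooth_sec0) + _ _.
rewrite (_ : (fun _ => _) = (fun=> 0 : 'rV[R]_n)); last first.
  by apply/funext => u'; rewrite addr0.
by move=> /eqP; rewrite eq_sym -subr_eq0 addrK => /eqP.
Qed.

Hypothesis regC : regular nabla.

Lemma rho_beta u x : slit M u -> rho u (beta nabla u x) = x.
Proof.
move=> su; case: (regC su (x, 0)) => -[w1 w2] [[/= w10 w20 w12] _].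
suff [] : [set v | deflection nabla u v = 0 /\ rho u v = x] (beta nabla u x) by [].
apply: xgetPex; exists w2; split=> //.
move: w10; rewrite !rhoE// => w10.
by rewrite -[RHS]/((x, 0 : 'rV[R]_n).1) w12 /= w10 add0r.
Qed.

(** In a chart, gamma X has base component 0 and beta Y has base component Y, the
    latter by [rho_beta]. The base component of their bracket is thus the
    derivative of the components of Y along gamma X: it involves neither the
    vertical part of beta Y, which depends on the connection, nor derivatives of
    the components of X. *)
Lemma rho_lie_gamma_beta X Y u : smooth_sec X -> smooth_sec Y -> slit M u ->
  rho u (lie_bracket (gammaf X) (betaf nabla Y) u)
  = 'D_(0, X u) (sec_rep Y (chart_at M u.1)) (coord (TM M) (chart_at M u.1) u).
Proof.
move=> sX sY su; rewrite (rhoE manM).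
pose c := chart_at M u.1; pose z := coord (TM M) c u.
pose Xc := vf_rep (gammaf X) c; pose Yc := vf_rep (betaf nabla Y) c.
have cu : dom M c u.1 by exact: dom_chart_at.
have Xc0 : \forall z' \near z, (fst \o Xc) z' = 0.
  apply: (near_slit (u := u)) => // u' cu' su'.
  by rewrite /comp /Xc (vf_rep_TME _ cu') (coord_change_gammaf _ cu').
have Ycb : \forall z' \near z, (fst \o Yc) z' = sec_rep Y c z'.
  apply: (near_slit (u := u)) => // u' cu' su'.
  rewrite /comp /Yc (vf_rep_TME _ cu') (sec_repE _ cu').
  rewrite (coord_change_TM_base manM _ (dom_chart_at manM _) cu').
  by rewrite -(rhoE manM u') /betaf rho_beta.
have XcE : Xc z = (0, X u).
  rewrite /Xc (vf_rep_TME _ cu) (coord_change_gammaf _ cu).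
  by rewrite (coord_change_id manM).
transitivity ('D_(Xc z) (fst \o Yc) z - 'D_(Yc z) (fst \o Xc) z); first by [].
have E1 : 'D_(Xc z) (fst \o Yc) z = 'D_(0, X u) (sec_rep Y c) z.
  by rewrite XcE; exact: near_eq_derive.
have E2 : 'D_(Yc z) (fst \o Xc) z = 0.
  have -> := near_eq_derive (Yc z) Xc0.
  exact: (derive_cst (0 : 'rV[R]_n) z (Yc z)).
exact: etrans (f_equal2 (fun a b => a - b) E1 E2) (subr0 _).
Qed.

Lemma mixed_torsionE X Y u : smooth_sec X -> smooth_sec Y -> slit M u ->
  mixed_torsion nabla X Y u = nabla u (gamma u (X u)) Y
  - 'D_(0, X u) (sec_rep Y (chart_at M u.1)) (coord (TM M) (chart_at M u.1) u).
Proof.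
move=> sX sY su; rewrite /mixed_torsion /torsion rho_lie_gamma_beta//.
have bY u' : slit M u' -> Y u' = rhof (betaf nabla Y) u'.
  by move=> su'; rewrite /rhof /betaf rho_beta.
rewrite -(conn_eq_on_slit _ bY)//.
have -> : rhof (gammaf X) = (fun=> 0).
  by apply/funext => u'; rewrite /rhof rhoE// /gammaf gammaE.
by rewrite conn0// subr0.
Qed.

Lemma smooth_conn_gamma X Y : smooth_sec X -> smooth_sec Y ->
  smooth_sec (fun u => nabla u (gamma u (X u)) Y).
Proof.
by move=> sX sY; case: linC => _ _ _; apply=> //; exact: smooth_gammaf.
Qed.

End Connection.

End Fields.

(** * Conformal Finsler manifolds *)

Lemma ratio_scale (K : fieldType) (e x a b : K) : e != 0 ->
  (e * x)^-1 * (e * a) * (e * b) = e * (x^-1 * a * b).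
Proof. by move=> e0; rewrite invfM (mulrACA _ _ e a) mulVf// mul1r mulrCA. Qed.

Section Finsler.
Context {R : realType} {n : nat}.
Variable M : charted 'rV[R]_n.
Hypothesis manM : smooth_manifold M.
Implicit Types (i j k : chart M) (u : TM M) (X Y Z : pi_field M).
Implicit Types (L : TM M -> R) (nabla : conn M).

Lemma metricBl L u x y z :
  metric L u (x - y) z = metric L u x z - metric L u y z.
Proof. by rewrite /metric !mulmxBl mxE [X in _ + X]mxE. Qed.

Lemma metricBr L u x y z :
  metric L u z (x - y) = metric L u z x - metric L u z y.
Proof. by rewrite /metric linearB mulmxBr mxE [X in _ + X]mxE. Qed.

Lemma smooth_fun_fibre L u w : smooth_fun (slit M) L -> w != 0 ->
  differentiable (fun w : 'rV[R]_n => L (u.1, w)) w /\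
  (forall v, differentiable (fun w => 'D_v (fun w : 'rV[R]_n => L (u.1, w)) w) w).
Proof.
move=> sL w0; pose c := chart_at M u.1; pose z := coord M c u.1.
pose Lc := L \o param (TM M) c.
have LE : (fun w => L (u.1, w)) = Lc \o (fun w => (z, w)).
  by apply/funext => w'; rewrite /Lc /comp param_chart_at.
have dz : differentiable (fun w : 'rV[R]_n => (z, w)) w.
  by apply: differentiable_pair; [exact: differentiable_cst|exact: ex_diff].
have zw : cimage (N := TM M) c (slit M) (z, w).
  rewrite cimage_slitE//; split=> //.
  by apply: cimage_coord; exact: dom_chart_at.
have [dL dDL] := sL 2%N c.
split.
  by rewrite LE; apply: differentiable_comp => //; exact: dL.
move=> v.
have -> : (fun w => 'D_v (fun w : 'rV[R]_n => L (u.1, w)) w)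
    = (fun z => 'D_(0, v) Lc z) \o (fun w => (z, w)).
  apply/funext => w'; rewrite LE; apply: derive_along_line => h.
  by rewrite vertical_line.
apply: differentiable_comp => //; have [dDv _] := dDL (0, v); exact: dDv.
Qed.

Lemma finsler_deriv_radial L u w : finsler L -> w != 0 ->
  'D_w (fun w : 'rV[R]_n => L (u.1, w)) w = L (u.1, w).
Proof.
move=> [_ _ _ HL _] w0; rewrite -[RHS](HL (u.1, w))//.
by rewrite /Liouville /gammaf act_gamma.
Qed.

Lemma metric_eta L u : finsler L -> slit M u ->
  metric L u (eta u) (eta u) = L u ^+ 2.
Proof.
move=> FL su; have [_ sL _ _ _] := FL.
have := @euler_hessian _ n (fun w => L (u.1, w)) u.2.
case: u su => p y su /= <-//.
- by move=> w w0; exact: (smooth_fun_fibre (p, y) sL w0).1.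
- by move=> v w w0; exact: (smooth_fun_fibre (p, y) sL w0).2.
- by move=> w w0; exact: (finsler_deriv_radial (p, y)).
Qed.

Section Conformal.
Variables (sigma : M -> R) (L L' : TM M -> R).
Hypotheses (FL : finsler L) (FL' : finsler L') (conf : conformal sigma L L').

Lemma metric_scale u x y : slit M u ->
  metric L' u x y = expR (2 * sigma (proj u)) * metric L u x y.
Proof. exact: conf. Qed.

Lemma conformal_energy u : slit M u ->
  L' u ^+ 2 = expR (2 * sigma (proj u)) * L u ^+ 2.
Proof. by move=> su; rewrite -(metric_eta FL') -?(metric_eta FL) ?metric_scale. Qed.

Lemma conformal_length u : slit M u -> L' u = expR (sigma (proj u)) * L u.
Proof.
move=> su; have [[L0 _] _ _ _ _] := FL; have [[L0' _] _ _ _ _] := FL'.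
apply/eqP; rewrite -(@eqrXn2 _ 2%N)//; last by rewrite mulr_ge0// expR_ge0.
by rewrite conformal_energy// exprMn expRM_natl.
Qed.

Lemma conformal_act_gamma u x : slit M u ->
  act L' u (gamma u x) = expR (sigma (proj u)) * act L u (gamma u x).
Proof.
move=> su; apply: (act_gamma_scale manM (c := fun p => expR (sigma p))) => //.
exact: conformal_length.
Qed.

Lemma conformal_angular u x y : slit M u ->
  angular_metric L' u x y = expR (2 * sigma (proj u)) * angular_metric L u x y.
Proof.
move=> su; rewrite /angular_metric !metric_scale// conformal_energy//.
by rewrite ratio_scale ?gt_eqF ?expR_gt0// -mulrBr.
Qed.

Variables (nabla nabla' : conn M).
Hypotheses (CL : cartan_connection L nabla) (CL' : cartan_connection L' nabla').

Let S X Y u : 'rV[R]_n :=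
  nabla' u (gamma u (X u)) Y - nabla u (gamma u (X u)) Y.

(** The difference of the two metric conditions, the second one divided by
    e^(2 sigma). *)
Lemma difference_metric X Y Z u : slit M u ->
  smooth_sec X -> smooth_sec Y -> smooth_sec Z ->
  metric L u (S X Y u) (Z u) + metric L u (Y u) (S X Z u) = 0.
Proof.
move=> su sX sY sZ.
have [_ gC _ _] := CL; have [_ gC' _ _] := CL'.
have := gC' u (gamma u (X u)) Y Z su sY sZ.
rewrite (@act_gamma_scale _ _ _ manM (fun p => expR (2 * sigma p))
  (fun u' => metric L u' (Y u') (Z u')))//; last first.
  by move=> u' su'; rewrite conf.
rewrite gC// !metric_scale// -mulrDr => /(mulfI (lt0r_neq0 (expR_gt0 _))) gE.
by rewrite /S metricBl metricBr addrACA -gE -opprD subrr.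
Qed.

(** By [mixed_torsionE] the difference of the connections is the difference of
    their mixed torsions, and both of these are symmetric with respect to g. *)
Lemma difference_symmetric X Y Z u : slit M u ->
  smooth_sec X -> smooth_sec Y -> smooth_sec Z ->
  metric L u (S X Y u) (Z u) = metric L u (S X Z u) (Y u).
Proof.
move=> su sX sY sZ.
have [[lC rC] _ _ tC] := CL; have [[lC' rC'] _ _ tC'] := CL'.
have T := tC X Y Z u su sX sY sZ.
have T' : metric L u (mixed_torsion nabla' X Y u) (Z u)
        = metric L u (mixed_torsion nabla' X Z u) (Y u).
  apply: (mulfI (lt0r_neq0 (expR_gt0 (2 * sigma (proj u))))).
  exact: etrans (esym (metric_scale _ _ su))
    (etrans (tC' X Y Z u su sX sY sZ) (metric_scale _ _ su)).
have SE V W : smooth_sec V -> metric L u (S X V u) (W u)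
    = metric L u (mixed_torsion nabla' X V u) (W u)
      - metric L u (mixed_torsion nabla X V u) (W u).
  move=> sV; rewrite (mixed_torsionE manM lC rC sX sV su).
  by rewrite (mixed_torsionE manM lC' rC' sX sV su) -metricBl opprB addrA subrK.
exact: etrans (SE Y Z sY)
  (etrans (f_equal2 (fun a b => a - b) T' T) (esym (SE Z Y sZ))).
Qed.

(** S Y is orthogonal to itself: the skewness below is used for the two sections
    whose difference is S Y. *)
Lemma vertical_invariant X Y u : slit M u -> smooth_sec X -> smooth_sec Y ->
  nabla' u (gamma u (X u)) Y = nabla u (gamma u (X u)) Y.
Proof.
move=> su sX sY; apply/eqP; rewrite -subr_eq0; apply/eqP.
rewrite -[LHS]/(S X Y u).
have [[lC rC] _ _ _] := CL; have [[lC' rC'] _ _ _] := CL'.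
have skew Z : smooth_sec Z ->
    metric L u (S X Y u) (Z u) + metric L u (Z u) (S X Y u) = 0.
  move=> sZ; rewrite difference_symmetric//; exact: difference_metric.
have sk1 := skew _ (smooth_conn_gamma manM lC sX sY).
have sk2 := skew _ (smooth_conn_gamma manM lC' sX sY).
have SS : metric L u (S X Y u) (S X Y u) + metric L u (S X Y u) (S X Y u) = 0.
  move: sk1 sk2; rewrite /S; set v1 := nabla u _ Y; set v2 := nabla' u _ Y.
  move=> sk1 sk2; rewrite {1}metricBr [X in _ + X = _]metricBl addrACA -opprD.
  by rewrite sk1 sk2 subr0.
have [_ _ _ _ posL] := FL.
apply: contra_eq SS => S0; rewrite gt_eqF// addr_gt0//; exact: posL.
Qed.

Lemma mixed_torsion_invariant X Y u : slit M u -> smooth_sec X -> smooth_sec Y ->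
  mixed_torsion nabla' X Y u = mixed_torsion nabla X Y u.
Proof.
move=> su sX sY.
have [[lC rC] _ _ _] := CL; have [[lC' rC'] _ _ _] := CL'.
rewrite (mixed_torsionE manM lC rC sX sY su).
by rewrite (mixed_torsionE manM lC' rC' sX sY su) vertical_invariant.
Qed.

Lemma mixed_tensor_invariant u x y : slit M u ->
  mixed_tensor nabla' u x y = mixed_tensor nabla u x y.
Proof.
by move=> su; rewrite /mixed_tensor mixed_torsion_invariant//; exact: smooth_ext.
Qed.

Lemma torsion_trace_invariant u a x : slit M u ->
  torsion_trace nabla' u a x = torsion_trace nabla u a x.
Proof.
move=> su; rewrite /torsion_trace.
have -> : mixed_tensor nabla' u (x ord0) = mixed_tensor nabla u (x ord0).
  by apply/funext => y; exact: mixed_tensor_invariant.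
by [].
Qed.

(** The case c = 1 is the invariance of vertical covariant derivatives. *)
Lemma cov_tensor_scale (c : M -> R) r s (W W' : ptensor M r s) X
    (a : 'I_r -> pi_form M) (Y : 'I_s -> pi_field M) u :
  slit M u -> smooth_sec X -> (forall l, smooth_sec (Y l)) ->
  (forall u a x, slit M u -> W' u a x = c (proj u) * W u a x) ->
  cov_tensor nabla' u (gamma u (X u)) W' a Y
  = c (proj u) * cov_tensor nabla u (gamma u (X u)) W a Y.
Proof.
move=> su sX sY WW'; rewrite /cov_tensor !mulrBr !mulr_sumr.
congr (_ - _ - _).
- by apply: act_gamma_scale => // u' su'; rewrite WW'.
- apply: eq_bigr => k _; rewrite WW'//; congr (_ * W u (upd _ _ _) _).
  apply/matrixP => l m; rewrite !mxE; cbv zeta.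
  by rewrite (vertical_invariant su sX (smooth_ext manM u (delta_mx 0 l))).
- by apply: eq_bigr => k _; rewrite WW'// (vertical_invariant su sX (sY k)).
Qed.

Lemma torsion03_scale u a x : slit M u ->
  torsion03 L' nabla' u a x = expR (2 * sigma (proj u)) * torsion03 L nabla u a x.
Proof.
move=> su.
by rewrite /torsion03 (metric_scale _ _ su) (mixed_tensor_invariant _ _ su).
Qed.

Lemma TTsummand_scale X Y Z W u : slit M u ->
  TTsummand L' nabla' X Y Z W u
  = expR (2 * sigma (proj u)) * TTsummand L nabla X Y Z W u.
Proof.
move=> su; rewrite /TTsummand (torsion03_scale _ _ su) (metric_scale _ _ su).
rewrite (conformal_energy su).
by rewrite ratio_scale ?gt_eqF ?expR_gt0.
Qed.

End Conformal.
End Finsler.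

Unset Implicit Arguments.

Theorem proposition4p4 (R : realType) (n : nat) (M : charted 'rV[R]_n)
    (sigma : M -> R) (L L' : TM M -> R) (nabla nabla' : conn M) :
  smooth_manifold M ->
  smooth_fun setT sigma ->
  finsler L -> finsler L' ->
  conformal sigma L L' ->
  cartan_connection L nabla -> cartan_connection L' nabla' ->
  (* (a) *)
  (forall (p : nat) (k : 'I_p.+1) (W W' : ptensor M 1 p.+1),
     is_ptensor W -> is_ptensor W' -> conf_invariant W W' ->
     conf_invariant (Tr k W) (Tr k W'))
  (* (b) *)
  /\ ((forall X Y : pi_field M, smooth_sec X -> smooth_sec Y ->
         conf_invariant (fun u => nabla u (gamma u (X u)) Y)
                        (fun u => nabla' u (gamma u (X u)) Y))
      /\ (forall (r s : nat) (W W' : ptensor M r s),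
            is_ptensor W -> is_ptensor W' -> conf_invariant W W' ->
            forall (X : pi_field M) (a : 'I_r -> pi_form M) (Y : 'I_s -> pi_field M),
              smooth_sec X -> (forall k, smooth_form (a k)) ->
              (forall k, smooth_sec (Y k)) ->
              conf_invariant
                (fun u => cov_tensor nabla u (gamma u (X u)) W a Y)
                (fun u => cov_tensor nabla' u (gamma u (X u)) W' a Y)))
  (* (c) *)
  /\ (forall X : pi_field M, smooth_sec X ->
        forall Y : pi_field M, smooth_sec Y ->
          conf_invariant (fun u => nabla u (gamma u (Y u)) X)
                         (fun u => nabla' u (gamma u (Y u)) X))
  (* (d) *)
  /\ ((forall X Y : pi_field M, smooth_sec X -> smooth_sec Y ->
         conf_invariant (mixed_torsion nabla X Y) (mixed_torsion nabla' X Y))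
      /\ (forall (X : pi_field M) (Y : 'I_1 -> pi_field M),
            smooth_sec X -> (forall k, smooth_sec (Y k)) ->
            conf_invariant
              (fun u => cov_tensor nabla u (gamma u (X u)) (torsion_trace nabla)
                          (@no_arg _) Y)
              (fun u => cov_tensor nabla' u (gamma u (X u)) (torsion_trace nabla')
                          (@no_arg _) Y)))
  (* (e) *)
  /\ ((forall x : 'rV[R]_n,
         conf_invariant (fun u => act L u (gamma u x) / L u)
                        (fun u => act L' u (gamma u x) / L' u))
      /\ (forall v : 'rV[R]_n * 'rV[R]_n,
            conf_invariant (fun u => act L u (Jmap u v) / L u)
                           (fun u => act L' u (Jmap u v) / L' u)))
  (* (f) *)
  /\ (forall x y : 'rV[R]_n,
        conf_sigma_invariant sigma (fun u => angular_metric L u x y)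
                                   (fun u => angular_metric L' u x y))
  (* (g) *)
  /\ (forall X Y Z W : pi_field M,
        smooth_sec X -> smooth_sec Y -> smooth_sec Z -> smooth_sec W ->
        conf_sigma_invariant sigma (TTtensor L nabla X Y Z W)
                                   (TTtensor L' nabla' X Y Z W)).
Proof.
move=> manM _ FL FL' conf CL CL'.
split; [|split; [|split; [|split; [|split; [|split]]]]].
- move=> p k W W' _ _ WW' u su; apply/funext => a; apply/funext => y.
  by rewrite /Tr WW'.
- split=> [X Y sX sY u su|r s W W' _ _ WW' X a Y sX _ sY u su].
    exact: (vertical_invariant manM FL conf CL CL').
  have := @cov_tensor_scale _ _ _ manM _ _ _ FL conf _ _ CL CL' (fun=> 1)
    r s W W' X a Y u su sX sY.
  by rewrite mul1r; apply => u' a' x' su'; rewrite mul1r WW'.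
- by move=> X sX Y sY u su; exact: (vertical_invariant manM FL conf CL CL').
- split=> [X Y sX sY u su|X Y sX sY u su].
    exact: (mixed_torsion_invariant manM FL conf CL CL').
  have := @cov_tensor_scale _ _ _ manM _ _ _ FL conf _ _ CL CL' (fun=> 1) 0 1
    (torsion_trace nabla) (torsion_trace nabla') X (@no_arg _) Y u su sX sY.
  rewrite mul1r; apply => u' a' x' su'; rewrite mul1r.
  exact: (torsion_trace_invariant manM FL conf CL CL').
- have E x u : slit M u ->
      act L' u (gamma u x) / L' u = act L u (gamma u x) / L u.
    move=> su; rewrite (conformal_act_gamma manM FL FL' conf)//.
    rewrite (conformal_length manM FL FL' conf)//.
    by rewrite -mulf_div divff ?mul1r// gt_eqF ?expR_gt0.
  by split=> [x u su|v u su]; rewrite ?/Jmap E.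
- by move=> x y u su; exact: (conformal_angular manM FL FL' conf).
- move=> X Y Z W sX sY sZ sW u su; rewrite /TTtensor.
  have sYZW l : smooth_sec (args3 Y Z W l).
    rewrite /args3 (tnth_nth Y); case: l => -[|[|[|l]]] hl.
    - exact: sY.
    - exact: sZ.
    - exact: sW.
    - by exfalso; move: hl.
  rewrite !(TTsummand_scale manM FL FL' conf CL CL' _ _ _ _ su).
  have -> := cov_tensor_scale manM FL conf CL CL'
    (c := fun p => expR (2 * sigma p))
    (@no_arg _) su sX sYZW (torsion03_scale manM FL conf CL CL').
  by rewrite -!mulrDr.
Qed.
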